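(* Let $f:X\to X$ be the endomorphism of the compact abelian group $X=\widehat{\mathbb{Z}[\frac13]}$ dual to the map $\phi:x\mapsto 2x$ on the (discrete) additive group $\mathbb{Z}[\frac13]$, and let $\mathcal{O}_n(f)$ denote the number of closed orbits of $f$ of length $n$. Then $$\tfrac12\log t+O(1)\;\le\;\sum_{n\le t}\frac{\mathcal{O}_n(f)}{2^n}\;\le\;\log t+O(1);$$ that is, there is a constant $C>0$ such that for all real $t\ge 1$, $$\tfrac12\log t-C\le \sum_{1\le n\le t}\frac{\mathcal{O}_n(f)}{2^n}\le \log t+C,$$ where the sum is over integers $n$.
   Context: $\mathbb{Z}[\frac13]$ is the ring of rationals whose denominator is a power of $3$. Its additive group is given the discrete topology, and $X=\widehat{\mathbb{Z}[\frac13]}$ is its Pontryagin dual (the compact group of characters $\chi:\mathbb{Z}[\frac13]\to S^1$). The dual map is $f=\widehat{\phi}$, $f(\chi)=\chi\circ\phi$, where $\phi(x)=2x$. A closed orbit of length $n$ of $f$ is a set $\{x,f(x),f^2(x),\dots,f^n(x)=x\}$ of cardinality $n$. The number of points fixed by $f^n$ is finite for every $n\ge1$, so $\mathcal{O}_n(f)$ is finite. $\log$ is the natural logarithm. *)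

(* Defs.v *)
From HB Require Import structures.
From mathcomp Require Import all_boot all_order all_algebra.
From mathcomp Require Import finmap complex.
From mathcomp Require Import all_classical all_reals all_analysis.

Set Implicit Arguments.
Unset Strict Implicit.
Unset Printing Implicit Defensive.
Import Order.TTheory GRing.Theory Num.Theory.

Local Open Scope ring_scope.
Local Open Scope classical_set_scope.

(* The subring Z[1/3] of rat; [3.-nat d] holds iff d is a power of 3 *)
Definition den_pow3 : {pred rat} := [pred x | (3%N).-nat `|denq x|%N].

Fact den_pow3P (x : rat) :
  x \in den_pow3 <-> exists (a : int) (k : nat), x * (3 ^+ k) = a%:~R.
Proof.
rewrite inE /=; split=> [/p_natP[] // k hk|[a [k xa]]].
  exists (numq x), k.
  have -> : (3 ^+ k : rat) = (denq x)%:~R.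
    by rewrite -absz_denq hk -pmulrn natrX.
  by rewrite -{1}[x]divq_num_den divfK // intr_eq0 denq_neq0.
suff : (`|denq x| %| 3 ^ k)%N by move=> h; apply: (pnat_dvd h); rewrite pnatX pnat_id.
have e : numq x * (3 ^ k)%N%:Z = a * denq x.
  apply: (@intr_inj rat); rewrite !intrM -xa -pmulrn natrX mulrAC.
  by rewrite -{2}[x]divq_num_den divfK // intr_eq0 denq_neq0.
have : (denq x %| numq x * (3 ^ k)%N%:Z)%Z by rewrite e dvdz_mull.
rewrite Gauss_dvdzr; first by rewrite /dvdz.
by rewrite coprimez_sym /coprimez /gcdz; have := coprime_num_den x; rewrite /coprime.
Qed.

Fact den_pow3_subring_closed : subring_closed den_pow3.
Proof.
split=> [|x y /den_pow3P[a [k xa]] /den_pow3P[b [l yb]]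
         |x y /den_pow3P[a [k xa]] /den_pow3P[b [l yb]]]; apply/den_pow3P.
- by exists 1, 0%N; rewrite mulr1.
- exists (a * 3 ^+ l - b * 3 ^+ k), (k + l)%N.
  rewrite exprD intrB !intrM -xa -yb !rmorphXn /= mulrBl mulrA.
  by congr (_ - _); rewrite -mulrA [3 ^+ l * _]mulrC.
- exists (a * b), (k + l)%N.
  by rewrite exprD intrM -xa -yb mulrACA.
Qed.

HB.instance Definition _ :=
  GRing.isSubringClosed.Build rat den_pow3 den_pow3_subring_closed.

Record Zinv3 := MkZinv3 { Zinv3_val :> rat; _ : Zinv3_val \in den_pow3 }.
HB.instance Definition _ := [isSub of Zinv3 for Zinv3_val].
HB.instance Definition _ := [Choice of Zinv3 by <:].
HB.instance Definition _ := [SubChoice_isSubComNzRing of Zinv3 by <:].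

Definition dbl (x : Zinv3) : Zinv3 := 2 * x.

Fact dbl_zmod_morphism : zmod_morphism dbl.
Proof. by move=> x y; rewrite /dbl mulrBr. Qed.
HB.instance Definition _ :=
  GRing.isZmodMorphism.Build Zinv3 Zinv3 dbl dbl_zmod_morphism.

(* Pontryagin dual of a discrete abelian group G: every homomorphism from G to
   the unit circle of R[i] is continuous.  Neither the topology nor the group
   law of the dual enters the count of closed orbits. *)
Record dual (R : realType) (G : zmodType) := MkDual {
  char_fun :> G -> R[i];
  char_unit : forall x, `|char_fun x| = 1;
  char_morph : {morph char_fun : x y / x + y >-> x * y} }.

Section DualMap.
Variables (R : realType) (G H : zmodType) (phi : {additive G -> H}).
Variable chi : dual R H.

Fact dual_map_unit x : `|(chi \o phi) x| = 1.
Proof. exact: char_unit. Qed.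

Fact dual_map_morph : {morph chi \o phi : x y / x + y >-> x * y}.
Proof. by move=> x y; rewrite /= raddfD char_morph. Qed.

Definition dual_map : dual R G := MkDual dual_map_unit dual_map_morph.
End DualMap.

(* The sets {x, f x, ..., f^n x = x} of cardinality n *)
Definition closed_orbits (T : Type) (f : T -> T) (n : nat) : set (set T) :=
  [set O | (exists2 x, iter n f x = x & O = [set iter k f x | k in `I_n.+1])
           /\ (O #= `I_n)%card].

(* This is the intended cardinality only when [closed_orbits f n] is finite
   ([fset_set] sends infinite sets to the empty one); this holds for the map
   considered here, whose iterates of order n >= 1 have finitely many fixed
   points. *)
Definition num_closed_orbits (T : Type) (f : T -> T) (n : nat) : nat :=
  #|` fset_set (closed_orbits f n)|.

(* Main.v *)
Require Import Defs.
From HB Require Import structures.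
From mathcomp Require Import all_boot all_order all_algebra.
From mathcomp Require Import separable cyclotomic finmap complex zify ring lra.
From mathcomp Require Import all_classical all_reals all_analysis.
Set Implicit Arguments.
Unset Strict Implicit.
Unset Printing Implicit Defensive.
Import Order.TTheory GRing.Theory Num.Theory.
Local Open Scope ring_scope.
Local Open Scope classical_set_scope.

(** Write F(n) for the number of points fixed by f^n, and O(n) for the number
    of closed orbits of length n.

    A character chi is fixed by f^n exactly when chi^N = 1 with N = 2^n - 1
    ([fixset_dblP]).  Such a chi is determined by chi(1): its values have order
    dividing the prime-to-3 part of N, and raising to the power 3^k is
    invertible on the roots of unity of that order, so that
    chi(a) = chi(a / 3^k)^(3^k) recovers chi(a / 3^k) ([torsion_char_inj]).
    As chi(1) is an N-th root of unity, F(n) <= 2^n - 1.  When n is odd, N is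
    prime to 3, cubing is invertible on all N-th roots of unity, and each of
    them is chi(1) for some chi ([pow_dual]); hence F(n) = 2^n - 1 for odd n
    ([card_fixset_dbl]).  For even n the 3-part of N is lost, but there only
    O(n) >= 0 is used.

    The points lying on closed orbits of length n are the points of least
    period n, and n of them lie on each orbit ([card_closed_orbits]).  So
    n O(n) <= F(n), and O(n) / 2^n <= 1 / n: the upper bound is the one for the
    harmonic sum.  Conversely a point fixed by f^n which does not have least
    period n is fixed by some f^d with 1 <= d <= n/2 ([fixset_half]), whence
    n O(n) >= F(n) - sum_(1 <= d <= n/2) F(d).  For n = 2i + 1 this gives
    O(n) / 2^n >= 1/n - 2^-i ([orbit_density_ge]).  The errors 2^-i add up to
    less than 2, and the sum of 1/n over odd n telescopes from below:
    1/n >= (ln(n+2) - ln n) / 2 ([ln_odd_step], [odd_sum_ge_ln]). *)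

(** * Closed orbits and points of least period n *)

Definition fixset (T : Type) (f : T -> T) n : set T := [set x | iter n f x = x].

Section Orbits.
Variables (T : choiceType) (f : T -> T).
Implicit Types (n k : nat) (x y : T).

Local Notation fixset := (fixset f).
Definition least_period n : set T :=
  [set x | fixset n x /\ forall k, (0 < k < n)%N -> ~ fixset k x].
Definition orb n x : set T := [set iter k f x | k in `I_n.+1].

Lemma fixset_mul n x k : fixset n x -> fixset (k * n) x.
Proof.
by move=> nx; elim: k => //= k IHk; rewrite /fixset/= mulSn iterD IHk.
Qed.

Lemma iter_modn n x k : fixset n x -> iter (k %% n) f x = iter k f x.
Proof.
by move=> nx; rewrite [in RHS](divn_eq k n) addnC iterD fixset_mul.
Qed.

Lemma iter_in_orb n x k : (0 < n)%N -> fixset n x -> orb n x (iter k f x).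
Proof.
move=> n0 nx; exists (k %% n)%N; last exact: iter_modn.
by rewrite /= ltnS ltnW// ltn_mod.
Qed.

Lemma orb_sym n x y : (0 < n)%N -> fixset n x -> orb n x y -> orb n y x.
Proof.
move=> n0 nx [k /= kn <-]; exists (n - k)%N; first by rewrite /= ltnS leq_subr.
by rewrite -iterD subnK.
Qed.

Lemma fixset_orb n x y k : fixset n x -> fixset k x -> orb n x y -> fixset k y.
Proof. by move=> nx kx [j _ <-]; rewrite /fixset/= -iterD addnC iterD kx. Qed.

Lemma orb_sub n x y : (0 < n)%N -> fixset n x -> orb n x y ->
  orb n y `<=` orb n x.
Proof.
move=> n0 nx [k _ <-] _ [j _ <-]; rewrite -iterD; exact: iter_in_orb.
Qed.

Lemma orb_eqP n x y : (0 < n)%N -> fixset n x -> fixset n y ->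
  orb n y = orb n x <-> orb n x y.
Proof.
move=> n0 nx ny; split=> [<-|xy]; first exact: (iter_in_orb 0).
apply/seteqP; split; apply: orb_sub => //; exact: orb_sym.
Qed.

Lemma least_period_orb n x y : (0 < n)%N ->
  least_period n x -> orb n x y -> least_period n y.
Proof.
move=> n0 [nx px] xy; split; first exact: fixset_orb xy.
move=> k kn ky; apply: (px _ kn); apply: (@fixset_orb n y) => //.
  exact: fixset_orb xy.
exact: orb_sym.
Qed.

Lemma iter_inj_lt n x i j : least_period n x -> (i < j < n)%N ->
  iter i f x <> iter j f x.
Proof.
move=> [nx px] /andP[ij jn] e; apply: (px (n - j + i)%N); first lia.
by rewrite /fixset/= iterD e -iterD subnK// ltnW.
Qed.

Lemma orb_image n x : (0 < n)%N -> fixset n x ->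
  orb n x = [set iter k f x | k in `I_n].
Proof.
move=> n0 nx; apply/seteqP; split=> _ [k /= kn <-]; last first.
  by exists k => //=; rewrite ltnW.
by exists (k %% n)%N; [rewrite /= ltn_mod | exact: iter_modn].
Qed.

(** The cardinality condition in the definition of closed orbits is the
    minimality of the period: a shorter period k would make the orbit the image
    of {0, .., k-1}. *)
Lemma card_orb n x : (0 < n)%N -> fixset n x ->
  (orb n x #= `I_n)%card <-> least_period n x.
Proof.
move=> n0 nx; split=> [cn|lx].
  split=> // k /andP[k0 kn] kx.
  have : (orb n x #<= `I_k)%card.
    suff -> : orb n x = [set iter j f x | j in `I_k] by exact: card_image_le.
    rewrite -(orb_image k0 kx); apply/seteqP; split=> _ [j /= jn <-].
      exact: iter_in_orb.
    by exists j => //=; lia.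
  by rewrite (card_le_eql cn) card_le_II; lia.
rewrite orb_image//; apply: inj_card_eq => i j; rewrite !inE /= => iN jN e.
case: (ltngtP i j) => // ij; [have := @iter_inj_lt n x i j lx|
  have := @iter_inj_lt n x j i lx]; rewrite ij ?iN ?jN => /(_ isT); congruence.
Qed.

Lemma closed_orbitsE n : (0 < n)%N ->
  closed_orbits f n = orb n @` least_period n.
Proof.
move=> n0; apply/seteqP; split=> [B [[x nx ->] /card_orb cx]|B [x lx <-]].
  by exists x => //; apply: cx.
split; first by exists x => //; case: lx.
by apply/card_orb => //; case: lx.
Qed.

(** Two points of least period n have the same orbit iff one lies on the orbit
    of the other, so the fibres of x |-> orb x are the orbits themselves, which
    have n elements each. *)
Lemma card_closed_orbits n : (0 < n)%N -> finite_set (least_period n) ->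
  (n * num_closed_orbits f n = #|` fset_set (least_period n)|)%N.
Proof.
move=> n0 fP; rewrite /num_closed_orbits closed_orbitsE// fset_set_image//.
set P := fset_set _.
have PE x : x \in P <-> least_period n x by rewrite in_fset_set// inE.
rewrite [RHS]card_fset_sum1 (partition_big_imfset _ (orb n)).
rewrite mulnC card_fset_sum1 big_distrl/=.
apply: eq_big_seq => _ /imfsetP[x /= /PE lx ->]; rewrite mul1n.
have [nx _] := lx.
rewrite sum1_count -size_filter.
(* The fibre over orb n x, as a filtered enumeration, is orb n x itself. *)
transitivity #|` fset_set (orb n x)|.
  apply/esym/card_fset_set; exact/(card_orb n0 nx).
apply/esym/perm_size/uniq_perm; rewrite ?filter_uniq// => y.
rewrite mem_filter (@in_fset_set _ (orb n x)); last first.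
  by apply/finite_setP; exists n; apply/(card_orb n0 nx).
apply/idP/idP.
  move=> /andP[/eqP yx yP]; apply: mem_set.
  have [ny _] := iffLR (PE y) yP; exact/orb_eqP.
move=> /set_mem xy; apply/andP; split.
  by apply/eqP/orb_eqP => //; apply: fixset_orb xy.
by have := iffRL (PE y) (least_period_orb n0 lx xy).
Qed.

(** If f^k and f^n fix x and k < n, then f^(n - k) fixes x too; the smaller of
    k and n - k is at most n / 2. *)
Lemma fixset_half n x : fixset n x -> least_period n x \/
  exists2 d, (0 < d <= n./2)%N & fixset d x.
Proof.
move=> nx; have [?|] := pselect (least_period n x); [by left|move=> h; right].
have [k kn kx] : exists2 k, (0 < k < n)%N & fixset k x.
  apply: contra_notP h => h; split=> // k kn kx; apply: h; by exists k.
have [kh|kh] := leqP k n./2; first by exists k => //; lia.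
exists (n - k)%N; first lia.
by rewrite /fixset/= -{1}kx -iterD subnK//; lia.
Qed.

Hypothesis fin : forall n, (0 < n)%N -> finite_set (fixset n).

Lemma finite_least_period n : (0 < n)%N -> finite_set (least_period n).
Proof. by move=> n0; apply: sub_finite_set (fin n0) => x []. Qed.

Lemma closed_orbits_le n : (0 < n)%N ->
  (n * num_closed_orbits f n <= #|` fset_set (fixset n)|)%N.
Proof.
move=> n0; rewrite card_closed_orbits//; last exact: finite_least_period.
apply: fsubset_leq_card; rewrite -fset_set_sub//; first by move=> x [].
- exact: finite_least_period.
- exact: fin.
Qed.

Lemma closed_orbits_ge n : (0 < n)%N ->
  (#|` fset_set (fixset n)| <= n * num_closed_orbits f n
     + \sum_(1 <= d < (n./2).+1) #|` fset_set (fixset d)|)%N.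
Proof.
move=> n0; rewrite card_closed_orbits//; last exact: finite_least_period.
have fP := finite_least_period n0.
pose U (r : seq nat) : set T :=
  least_period n `|` [set x | exists2 d, d \in r & fixset d x].
(* The union bound is proved along a list of exponents d; finiteness has to go
   along with it, [fset_set] being empty on infinite sets. *)
have bigle (r : seq nat) : {in r, forall d, 0 < d}%N ->
    (#|` fset_set (U r)| <= #|` fset_set (least_period n)|
                            + \sum_(d <- r) #|` fset_set (fixset d)|)%N
    /\ finite_set (U r).
  elim: r => [_|d r IHr r0].
    rewrite /U big_nil addn0 (_ : [set x | _] = set0) ?setU0//.
    by apply/seteqP; split=> x // [].
  have [|le1 fin1] := IHr; first by move=> k kr; apply: r0; rewrite inE kr orbT.
  have fd : finite_set (fixset d) by apply: fin; apply: r0; rewrite mem_head.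
  have -> : U (d :: r) = fixset d `|` U r.
    apply/seteqP; split=> x.
      move=> [lx|[k]]; first by right; left.
      by rewrite inE => /orP[/eqP->|kr kx]; [left|right; right; exists k].
    move=> [dx|[lx|[k kr kx]]]; [right; exists d|left|right; exists k] => //.
      exact: mem_head.
    by rewrite inE kr orbT.
  split; last by rewrite finite_setU.
  rewrite fset_setU// cardfsU big_cons; lia.
have [|le1 fin1] := bigle (index_iota 1 n./2.+1).
  by move=> d; rewrite mem_index_iota => /andP[].
apply: leq_trans le1; apply: fsubset_leq_card.
rewrite -fset_set_sub//; last exact: fin.
move=> x /fixset_half[|[d dn dx]]; first by left.
by right; exists d => //; rewrite mem_index_iota ltnS.
Qed.
End Orbits.

(** * Characters of a discrete group *)

(** X^N - 1 splits over F and is separable when N is nonzero in F. *)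
Lemma unity_roots_closed (F : closedFieldType) N : N%:R != 0 :> F ->
  exists rs : seq F, [/\ uniq rs, size rs = N &
    forall z, (z \in rs) = (z ^+ N == 1)].
Proof.
move=> N0; have Ngt0 : (0 < N)%N by case: N N0 => //; rewrite eqxx.
have [rs] := closed_field_poly_normal ('X^N - 1 : {poly F}).
rewrite (eqP (monicXnsubC _ Ngt0)) scale1r => e; exists rs; split.
- by rewrite -separable_prod_XsubC -e separable_Xn_sub_1.
- by apply: succn_inj; rewrite -(size_prod_XsubC rs id)/= -e size_XnsubC.
- by move=> z; rewrite -root_prod_XsubC -e -unity_rootE.
Qed.

Lemma unity_root_norm (K : numDomainType) (z : K) N :
  (0 < N)%N -> z ^+ N = 1 -> `|z| = 1.
Proof.
move=> N0 /(congr1 Num.norm); rewrite normrX normr1 => /eqP.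
by rewrite pexpr_eq1// => /eqP.
Qed.

(** A classical choice structure on the dual, for its subsets to be convertible
    to finite sets. *)
HB.instance Definition _ (R : realType) (G : zmodType) :=
  gen_eqMixin (dual R G).
HB.instance Definition _ (R : realType) (G : zmodType) :=
  gen_choiceMixin (dual R G).

Section Characters.
Variables (R : realType) (G : zmodType).
Implicit Types (chi : dual R G) (x : G).

Lemma dual_ext chi1 chi2 : chi1 =1 chi2 -> chi1 = chi2.
Proof.
case: chi1 chi2 => [c1 u1 m1] [c2 u2 m2] /= /funext e.
by case: _ / e in u2 m2 *; congr MkDual; exact: Prop_irrelevance.
Qed.

Lemma char_neq0 chi x : chi x != 0.
Proof. by rewrite -normr_eq0 char_unit oner_eq0. Qed.

Lemma char0 chi : chi 0 = 1.
Proof.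
by apply: (mulfI (char_neq0 chi 0)); rewrite -char_morph addr0 mulr1.
Qed.

Lemma charMn chi x n : chi (x *+ n) = chi x ^+ n.
Proof.
by elim: n => [|n IHn]; [rewrite char0|rewrite mulrS char_morph IHn exprS].
Qed.

Lemma charN chi x : chi (- x) = (chi x)^-1.
Proof.
apply: (mulfI (char_neq0 chi x)).
by rewrite -char_morph subrr char0 divff// char_neq0.
Qed.

Lemma charMz chi x (a : int) : chi (x *~ a) = chi x ^ a.
Proof. by case: a => n; rewrite ?NegzE ?mulrNz ?charN -pmulrn charMn. Qed.
End Characters.

(** * Characters of Z[1/3] fixed by the iterates of the dual of doubling *)

Section Doubling.
Variable R : realType.
Implicit Type chi : dual R Zinv3.
Let f : dual R Zinv3 -> dual R Zinv3 := dual_map dbl.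

Lemma iter_dual_dbl n chi x : iter n f chi x = chi x ^+ (2 ^ n).
Proof.
elim: n x => [|n IHn] x //=.
by rewrite IHn /dbl mulr_natl charMn -exprM expnS.
Qed.

(** chi(2^n x) = chi(x)^(2^n), and chi(x) can be cancelled. *)
Lemma fixset_dblP n chi :
  fixset f n chi <-> forall x, chi x ^+ (2 ^ n - 1) = 1.
Proof.
have e x : chi x * chi x ^+ (2 ^ n - 1) = chi x ^+ (2 ^ n).
  by rewrite -exprS subn1 prednK// expn_gt0.
split=> [nchi x|nchi].
  by apply: (mulfI (char_neq0 chi x)); rewrite e -iter_dual_dbl nchi mulr1.
by apply: dual_ext => x; rewrite iter_dual_dbl -e nchi mulr1.
Qed.

Fact inv3_den : 3^-1 \in den_pow3.
Proof. by apply/den_pow3P; exists 1, 1%N; rewrite mulVf. Qed.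
Definition inv3 : Zinv3 := MkZinv3 inv3_den.

Lemma inv3K (x : Zinv3) k : x * inv3 ^+ k *+ 3 ^ k = x.
Proof.
have e : inv3 *+ 3 = 1.
  by apply: val_inj; rewrite raddfMn/= -[LHS]mulr_natr mulVf.
elim: k => [|k IHk]; first by rewrite mulr1.
rewrite -[RHS]IHk expnS mulrnA exprS mulrCA [inv3 * _]mulrC -[_ *+ 3]mulrnAr.
by rewrite e mulr1.
Qed.

Lemma Zinv3_num (x : Zinv3) : exists (a : int) k, x *+ 3 ^ k = 1 *~ a.
Proof.
have /den_pow3P[a [k xa]] := valP x; exists a, k.
by apply: val_inj; rewrite raddfMn raddfMz/= -[LHS]mulr_natr natrX xa.
Qed.

(** The exponent b depends on x and N alone.  Let N = M 3^s with M prime to 3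
    and x 3^k = a.  As x is divisible by 3^s, chi(x)^M = 1; choosing v with
    v 3^k = 1 mod M, chi(x) = chi(x)^(3^k v) = chi(a)^v = chi(1)^(a v). *)
Lemma torsion_char_val N : (0 < N)%N -> forall x : Zinv3, exists b : int,
  forall chi, (forall y, chi y ^+ N = 1) -> chi x = chi 1 ^ b.
Proof.
move=> N0 x; have [a [k xa]] := Zinv3_num x.
have [M cM NE] := pfactor_coprime (isT : prime 3) N0.
have /(egcdnP M)[v u vu _] : (0 < 3 ^ k)%N by rewrite expn_gt0.
exists (a * v%:Z) => chi chiN.
have chiM : chi x ^+ M = 1.
  by rewrite -(inv3K x (logn 3 N)) charMn -exprM mulnC -NE.
have <- : chi x ^+ (3 ^ k * v) = chi x.
  rewrite mulnC vu (eqP (coprimeXl k cM)) exprD expr1 mulnC exprM chiM.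
  by rewrite expr1n mul1r.
by rewrite exprM -charMn xa charMz -exprz_exp.
Qed.

Lemma torsion_char_inj N chi1 chi2 : (0 < N)%N ->
  (forall y, chi1 y ^+ N = 1) -> (forall y, chi2 y ^+ N = 1) ->
  chi1 1 = chi2 1 -> chi1 = chi2.
Proof.
move=> N0 h1 h2 e; apply: dual_ext => x.
by have [b bE] := torsion_char_val N0 x; rewrite !bE// e.
Qed.

(** Since w inverts 3 modulo the order of z, the value at a / 3^k of a character
    sending 1 to z can be taken to be z^(a w^k). *)
Section PowerCharacter.
Variables (z : R[i]) (N w : nat).
Hypotheses (N0 : (0 < N)%N) (zN : z ^+ N = 1) (w3 : z ^+ (3 * w) = z).

Definition pow_char (x : Zinv3) : R[i] :=
  z ^ (numq (val x) * (w ^ logn 3 `|denq (val x)|)%N).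

Let z0 : z != 0.
Proof.
by apply: contra_eq_neq zN => ->; rewrite expr0n gtn_eqF// eq_sym oner_neq0.
Qed.

Lemma pow_char_root (a : int) : (z ^ a) ^+ N = 1.
Proof. by rewrite exprnP exprzAC -exprnP zN exp1rz. Qed.

(** The power z^(a w^k) depends only on the rational a / 3^k, so the choice of a
    denominator in [pow_char] is immaterial. *)
Lemma pow_char_indep (a b : int) k l : a * 3 ^+ l = b * 3 ^+ k ->
  z ^ (a * (w ^ k)%N) = z ^ (b * (w ^ l)%N).
Proof.
move=> ab; have zw j : z = z ^ ((3 * w) ^ j)%N.
  elim: j => // j IHj.
  by rewrite expnS PoszM -exprz_exp -[z ^ (3 * w)%N]exprnP w3.
rewrite [in LHS](zw l) [in RHS](zw k) !exprz_exp !expnMn; congr (z ^ _).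
have PX m j : (m ^ j)%N = m%:Z ^+ j :> int by rewrite -natz natrX natz.
rewrite !PoszM !PX -[Posz 3]/(3 : int).
transitivity ((a * 3 ^+ l) * (w%:Z ^+ l * w%:Z ^+ k)); first by ring.
by rewrite ab; ring.
Qed.

Lemma pow_charE (x : Zinv3) (a : int) k : val x * 3 ^+ k = a%:~R ->
  pow_char x = z ^ (a * (w ^ k)%N).
Proof.
move=> xa; apply: pow_char_indep; apply: (@intr_inj rat).
have /p_natP[j dj] := valP x.
rewrite !rmorphM/= !rmorphXn/= -xa dj pfactorK// mulrAC; congr (_ * _).
rewrite -[val x in RHS]divq_num_den -[denq _ in RHS]absz_denq dj.
by rewrite -pmulrn natrX divfK// expf_neq0.
Qed.

Fact pow_char_unit x : `|pow_char x| = 1.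
Proof. exact: unity_root_norm N0 (pow_char_root _). Qed.

Fact pow_char_morph : {morph pow_char : x y / x + y >-> x * y}.
Proof.
move=> x y; have /den_pow3P[a [k xa]] := valP x.
have /den_pow3P[b [l yb]] := valP y.
rewrite (pow_charE xa) (pow_charE yb).
rewrite (@pow_charE (x + y) (a * 3 ^+ l + b * 3 ^+ k) (k + l)); last first.
  rewrite intrD !intrM !rmorphXn/= -xa -yb exprD raddfD/=; ring.
rewrite mulrDl expfzDr//.
by congr (_ * _); apply: pow_char_indep; rewrite exprD; ring.
Qed.

Definition pow_dual : dual R Zinv3 := MkDual pow_char_unit pow_char_morph.

Lemma pow_dual1 : pow_dual 1 = z.
Proof. by rewrite /= (@pow_charE 1 1 0) ?mulr1. Qed.

Lemma pow_dual_torsion x : pow_dual x ^+ N = 1.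
Proof. exact: pow_char_root. Qed.
End PowerCharacter.

Lemma card_fixset_dbl n : (0 < n)%N ->
  [/\ finite_set (fixset f n),
     (#|` fset_set (fixset f n)| <= 2 ^ n - 1)%N &
     odd n -> (2 ^ n - 1 <= #|` fset_set (fixset f n)|)%N].
Proof.
move=> n0; set N := (2 ^ n - 1)%N.
have N0 : (0 < N)%N by rewrite subn_gt0 -{1}(expn0 2) ltn_exp2l.
have [|rs [rsu rss rsE]] := @unity_roots_closed R[i] N.
  by rewrite pnatr_eq0 -lt0n.
(* g numbers the root of unity chi(1): it embeds the fixed points of f^n in
   {0, .., N-1}. *)
set A := fixset f n; pose g (chi : dual R Zinv3) := index (chi 1) rs.
have gA chi : A chi -> (g chi < N)%N.
  by move=> /fixset_dblP Achi; rewrite /g -rss index_mem rsE; apply/eqP.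
have gK chi : A chi -> nth 0 rs (g chi) = chi 1.
  by move=> /gA; rewrite -rss index_mem; exact: nth_index.
have cA : (g @` A #= A)%card.
  apply: inj_card_eq => c1 c2 /set_mem A1 /set_mem A2 e.
  apply: (torsion_char_inj N0); [exact/fixset_dblP|exact/fixset_dblP|].
  by rewrite -gK// e gK.
have leA : (A #<= `I_N)%card.
  rewrite -(card_le_eql cA); apply: subset_card_le => _ [chi + <-]; exact: gA.
have finA : finite_set A by exact: card_le_finite leA (finite_II N).
split=> //; first exact: geq_card_fset_set.
move=> on; apply: leq_card_fset_set => //.
rewrite -(card_le_eqr cA); apply: subset_card_le => i /= iN.
set z := nth 0 rs i.
have zN : z ^+ N = 1 by apply/eqP; rewrite -rsE mem_nth ?rss.
(* For n odd, N = 1 mod 3, so that the inverse of 3 modulo N is (2N+1)/3. *)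
have w3 : z ^+ (3 * ((2 * N).+1 %/ 3)) = z.
  rewrite mulnC divnK; first by rewrite exprS mulnC exprM zN expr1n mulr1.
  have [m nE] : exists m, n = m.*2.+1 by exists n./2; lia.
  have [q qE] : exists q, (4 ^ m = 3 * q + 1)%N.
    elim: m {nE} => [|m [q qE]]; first by exists 0%N.
    by exists (4 * q + 1)%N; rewrite expnS; lia.
  apply/dvdnP; exists (4 * q + 1)%N; rewrite /N nE expnS -mul2n expnM qE; lia.
exists (pow_dual N0 zN w3); last by rewrite /g pow_dual1 index_uniq ?rss.
by apply/fixset_dblP => x; rewrite pow_dual_torsion.
Qed.
End Doubling.

(** * Logarithmic bounds for sums of reciprocals *)

(** ln(1 + x) <= x at x = -1/(n+1) gives 1/(n+1) <= ln(n+1) - ln n. *)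
Lemma harmonic_le_ln (R : realType) N : (0 < N)%N ->
  \sum_(1 <= n < N.+1) (n%:R : R)^-1 <= 1 + ln N%:R.
Proof.
elim: N => // -[_ _|N /(_ isT) IHN _].
  by rewrite big_nat1 invr1 ln1 addr0.
rewrite big_nat_recr//=; set a : R := N.+1%:R; set b : R := N.+2%:R.
have a0 : 0 < a by rewrite ltr0n.
have b0 : 0 < b by rewrite ltr0n.
have ab : b = a + 1 by rewrite /b -natr1.
have bV : b^-1 < 1 by rewrite invf_lt1// ab ltrDr.
have /le_ln1Dx : -1 < - b^-1 by rewrite ltrN2.
have -> : 1 + - b^-1 = a / b by rewrite ab; field; apply: lt0r_neq0; lra.
rewrite ln_div ?posrE// => lnab; rewrite -lerBrDr; apply: le_trans IHN _.
by rewrite -/a; move: lnab; generalize (b^-1) => c; lra.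
Qed.

(** ln(1 + x) <= x at x = 2/n for n = 2m+1. *)
Lemma ln_odd_step (R : realType) m :
  ln (m.+1.*2.+1%:R : R) <= ln m.*2.+1%:R + 2 * m.*2.+1%:R^-1.
Proof.
set a : R := m.*2.+1%:R; set b : R := (m.+1.*2.+1)%:R.
have a0 : 0 < a by rewrite ltr0n.
have b0 : 0 < b by rewrite ltr0n.
have ab : b = a + 2 by rewrite /b /a doubleS -addn2 natrD.
clearbody a b; have aV0 : 0 < 2 * a^-1 by rewrite mulr_gt0// invr_gt0.
have /le_ln1Dx : -1 < 2 * a^-1 by lra.
have -> : 1 + 2 * a^-1 = b / a by rewrite ab; field; rewrite gt_eqF.
rewrite ln_div ?posrE//; lra.
Qed.

(** With u = uphalf N, the odd numbers up to N are 1, 3, .., 2u-1.  Each of them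
    contributes the logarithmic increment minus its error 2^-i; the errors for
    i < u sum to 2 - 2 * 2^-u. *)
Lemma odd_sum_ge_ln (R : realType) (o : nat -> R) :
  (forall n, 0 <= o n) ->
  (forall i, i.*2.+1%:R^-1 - 2^-1 ^+ i <= o i.*2.+1) ->
  forall N, 2^-1 * ln (uphalf N).*2.+1%:R - 2 + 2 * 2^-1 ^+ uphalf N
    <= \sum_(1 <= n < N.+1) o n.
Proof.
move=> o0 oodd; elim=> [|N IHN]; first by rewrite big_geq// ln1 expr0; lra.
rewrite big_nat_recr//=; have [Nodd|Neven] := boolP (odd N).
  have -> : N./2.+1 = uphalf N by rewrite uphalf_half Nodd.
  by apply: (le_trans IHN); rewrite lerDl.
have e : uphalf N = N./2 by rewrite uphalf_half (negbTE Neven).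
have eN : N.+1 = N./2.*2.+1 by rewrite even_halfK.
rewrite e in IHN; have := oodd N./2; rewrite -eN.
have := ln_odd_step R N./2; rewrite -eN exprS; move: IHN; rewrite -eN.
move: N.+1%:R^-1 (ln N.+1%:R) (ln _.*2.+1%:R) (2^-1 ^+ _) => x l l' p.
lra.
Qed.

(** * Orbit counts for the dual of doubling *)

Lemma sum_pow2_le i : (\sum_(1 <= d < i.+1) (2 ^ d - 1) + 2 <= 2 ^ i.+1)%N.
Proof.
elim: i => [|i IHi]; first by rewrite big_geq.
have := expn_gt0 2 i.+1; rewrite big_nat_recr//= (expnS 2 i.+1); lia.
Qed.

Section OrbitDensity.
Variable R : realType.
Let f : dual R Zinv3 -> dual R Zinv3 := dual_map dbl.
Let fin n (n0 : (0 < n)%N) : finite_set (fixset f n).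
Proof. by case: (card_fixset_dbl R n0). Qed.

Lemma orbit_density_le n : (0 < n)%N ->
  (num_closed_orbits f n)%:R / 2 ^+ n <= n%:R^-1 :> R.
Proof.
move=> n0; have [_ le2 _] := card_fixset_dbl R n0.
have := leq_trans (closed_orbits_le fin n0) le2.
rewrite ler_pdivrMr ?exprn_gt0// mulrC ler_pdivlMr ?ltr0n//.
rewrite -natrX -natrM ler_nat.
by move=> /leq_trans le3; rewrite mulnC; apply: le3; exact: leq_subr.
Qed.

(** Here n = 2i+1: the fixed points of f^d with 1 <= d <= i are at most
    2^(i+1) - 2 in all, and 2^(i+1) / 2^n = 2^-i. *)
Lemma orbit_density_ge i :
  i.*2.+1%:R^-1 - 2^-1 ^+ i
    <= (num_closed_orbits f i.*2.+1)%:R / 2 ^+ i.*2.+1 :> R.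
Proof.
set n := i.*2.+1; have n0 : (0 < n)%N by [].
have [_ _ ge2] := card_fixset_dbl R n0.
have : (2 ^ n <= n * num_closed_orbits f n + 2 ^ i.+1)%N.
  have nodd : odd n by rewrite /= odd_double.
  have := leq_trans (ge2 nodd) (closed_orbits_ge fin n0).
  have -> : n./2 = i by rewrite /n -[i.*2.+1]/(true + i.*2)%N half_bit_double.
  have : (\sum_(1 <= d < i.+1) #|` fset_set (fixset f d)| <=
          \sum_(1 <= d < i.+1) (2 ^ d - 1))%N.
    rewrite big_nat [leqRHS]big_nat; apply: leq_sum => d /andP[d0 _].
    by have [_ +] := card_fixset_dbl R d0.
  move=> le1 le2; have := leq_trans le2 (leq_add (leqnn _) le1).
  have := sum_pow2_le i; have : (0 < 2 ^ n)%N by rewrite expn_gt0.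
  move: (num_closed_orbits f n) (\sum_(1 <= d < i.+1) _)%N (2 ^ n)%N => a s p.
  move: (n * a)%N (2 ^ i.+1)%N; lia.
rewrite -(ler_nat R) natrD natrM !natrX.
have -> : 2 ^+ n = 2 ^+ i.+1 * 2 ^+ i :> R.
  by rewrite -exprD; congr (_ ^+ _); rewrite /n -addnn addSn.
rewrite exprVn; set p : R := 2 ^+ i; set q := 2 ^+ i.+1; set c := _%:R.
set o := (num_closed_orbits f n)%:R : R => H.
have p0 : 0 < p by rewrite exprn_gt0.
have q0 : 0 < q by rewrite exprn_gt0.
have c1 : 1 <= c by rewrite ler1n.
have c0 : 0 < c by lra.
rewrite lerBlDr -(ler_pM2l c0) divff ?gt_eqF// mulrDr.
have : 1 - p^-1 <= c * (o / (q * p)).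
  have -> : 1 - p^-1 = (q * p - q) / (q * p) by field; rewrite !gt_eqF.
  by rewrite mulrA ler_pM2r ?invr_gt0 ?mulr_gt0//; lra.
have : p^-1 <= c * p^-1 by rewrite ler_peMl// invr_ge0 ltW.
lra.
Qed.
End OrbitDensity.

Theorem theorem5 (R : realType) :
  let f : dual R Zinv3 -> dual R Zinv3 := dual_map dbl in
  exists2 C : R, 0 < C & forall t : R, 1 <= t ->
    2^-1 * ln t - C
      <= \sum_(1 <= n < (Num.truncn t).+1) (num_closed_orbits f n)%:R / 2 ^+ n
      <= ln t + C.
Proof.
move=> f; exists 2 => // t t1; have t0 : 0 < t := lt_le_trans ltr01 t1.
have /andP[Nt tN] := truncn_itv (ltW t0).
set N := Num.truncn t in Nt tN *; apply/andP; split.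
  have o0 n : 0 <= (num_closed_orbits f n)%:R / 2 ^+ n :> R.
    by rewrite divr_ge0// exprn_ge0.
  apply: le_trans (odd_sum_ge_ln o0 (@orbit_density_ge R) N).
  have Nu : N.+1%:R <= (uphalf N).*2.+1%:R :> R.
    rewrite ler_nat uphalf_half doubleD; have := odd_double_half N; lia.
  have : ln t <= ln (uphalf N).*2.+1%:R.
    rewrite ler_ln ?posrE ?ltr0n//; exact: le_trans (ltW tN) Nu.
  have : 0 < 2^-1 ^+ uphalf N :> R by rewrite exprn_gt0.
  lra.
have N1 : (0 < N)%N by rewrite truncn_gt0.
apply: (@le_trans _ _ (1 + ln N%:R)).
  apply: le_trans (harmonic_le_ln R N1); rewrite big_nat [leRHS]big_nat.
  by apply: ler_sum => n /andP[n0 _]; exact: orbit_density_le.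
have : ln N%:R <= ln t by rewrite ler_ln ?posrE ?ltr0n.
lra.
Qed.
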